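(* Let $G$ be a finite group and $p$ a prime number. The following assertions hold: (1) $\mathcal{A}_p(G)$ is contractible in $0$ steps if and only if $G$ has only one subgroup of order $p$, i.e. $\Omega_1(G)\simeq\mathbb{Z}_p$. (2) $\mathcal{A}_p(G)$ is contractible in $1$ step if and only if $\mathcal{A}_p(G)$ has a maximum, if and only if $\Omega_1(G)$ is abelian. (3) $\mathcal{A}_p(G)$ is contractible in $2$ steps if and only if the intersection of all maximal $p$-tori of $G$ is non-trivial, if and only if $p$ divides $|C_G(\Omega_1(G))|$. (4) $\mathcal{A}_p(G)$ is contractible in $3$ steps if and only if there exists a $p$-torus subgroup of $G$ which intersects (in a non-trivial way) every non-trivial intersection of maximal $p$-tori of $G$.
   Context: $\mathcal{A}_p(G)$ is the poset of non-trivial elementary abelian $p$-subgroups of $G$ (called $p$-tori), ordered by inclusion; a maximal $p$-torus is a maximal element of $\mathcal{A}_p(G)$. $\Omega_1(G)$ is the subgroup of $G$ generated by the elements of order $p$, and $C_G(H)$ is the centralizer of $H$ in $G$. $\mathbb{Z}_p$ is the cyclic group of order $p$. For a finite poset $X$ and an integer $n\ge 0$, $X$ is contractible in $n$ steps if there exist $x_0\in X$ and order-preserving maps $\mathrm{Id}_X=f_0,f_1,\ldots,f_n=c_{x_0}:X\to X$, where $c_{x_0}$ is the constant map with value $x_0$, such that for every $0\le i<n$ the maps $f_i,f_{i+1}$ are comparable (pointwise: $f_i\le f_{i+1}$ or $f_i\geq f_{i+1}$).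
   Formalization: The equivalence with ''Ω₁(G) is abelian'' in (2) and with the non-trivial intersection of all maximal p-tori in (3) are stated only when p divides |G|; otherwise A_p(G) is empty, Ω₁(G)=1 is abelian without a maximum existing, and the intersection is over an empty family. *)

(* Defs.v *)
From HB Require Import structures.
From mathcomp Require Import all_boot all_order all_fingroup all_solvable.
Set Implicit Arguments.
Unset Strict Implicit.
Unset Printing Implicit Defensive.
Import Order.TTheory GroupScope.

Definition contractible_in_steps (d : Order.disp_t) (X : finPOrderType d)
    (n : nat) : Prop :=
  exists (x0 : X) (f : nat -> X -> X),
    [/\ f 0%N =1 id,
        f n =1 (fun=> x0),
        forall i, (i <= n)%N ->
          {homo f i : x y / (x <= y)%O}
      & forall i, (i < n)%N ->
          (forall x, (f i x <= f i.+1 x)%O) \/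
          (forall x, (f i.+1 x <= f i x)%O)].

Definition has_maximum (d : Order.disp_t) (X : porderType d) : Prop :=
  exists m : X, forall x : X, (x <= m)%O.

Section PTori.
Variables (gT : finGroupType) (p : nat).
Implicit Type G : {group gT}.

(* Unlike 'E_p(G), this excludes the trivial group. *)
Definition ptori G : {set {group gT}} :=
  [set E : {group gT} | [&& E \subset G, p.-abelem E & E :!=: 1]].

Definition max_ptori G : {set {group gT}} :=
  [set E : {group gT} | [max E | E \in ptori G]].

(* 'Ohm_1(G) is generated by the elements of any prime order, so it is the
   wrong subgroup unless G is a p-group. *)
Definition Omega1 G : {group gT} := <<[set x in G | #[x] == p]>>%G.

Definition Ap G : Type := {E : {group gT} | E \in ptori G}.

HB.instance Definition _ G := Finite.on (Ap G).

Definition Ap_le G : rel (Ap G) := fun E F => val E \subset val F.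

Fact Ap_le_refl G : reflexive (@Ap_le G).
Proof. by move=> E; apply: subxx. Qed.

Fact Ap_le_anti G : antisymmetric (@Ap_le G).
Proof. by move=> E F EF; apply/val_inj/val_inj/eqP; rewrite eqEsubset. Qed.

Fact Ap_le_trans G : transitive (@Ap_le G).
Proof. by move=> F E K; apply: subset_trans. Qed.

Fact Ap_display : Order.disp_t. Proof. exact: Order.Disp tt tt. Qed.

HB.instance Definition _ G :=
  Order.Le_isPOrder.Build Ap_display (Ap G)
    (@Ap_le_refl G) (@Ap_le_anti G) (@Ap_le_trans G).

End PTori.

(* Main.v *)
Require Import Defs.
From HB Require Import structures.
From mathcomp Require Import all_boot all_order all_algebra all_fingroup all_solvable.
Set Implicit Arguments.
Unset Strict Implicit.
Unset Printing Implicit Defensive.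
Import Order.TTheory GroupScope.


(** A fence of monotone self-maps from the identity to a constant [Z] of the
    poset of tori is rigid at its first step: a map above the identity fixes
    every maximal torus, and a map below the identity fixes every subgroup of
    order [p], these being the minimal tori.

    A torus lies in all maximal tori exactly when it centralizes
    [Omega1 p G] ([ptori_cent_Omega1P]); call it central. A central torus [Z]
    contracts the poset in two steps, by [E <= E <*> Z >= Z]. Conversely, in
    each of the four shapes of a two-step fence, the torus [Z] has a common
    upper bound with every subgroup of order [p]; tori being abelian, [Z] is
    then central ([central_torus_of_bounds]). The group-theoretic conditions
    for two steps only rephrase the existence of a central torus: if [p]
    divides the order of [G], so that there are maximal tori, their
    intersection is one if it is nontrivial, and by Cauchy's theorem so is a
    cyclic subgroup of order [p] of ['C_G(Omega1 p G)].

    For three steps, consecutive comparisons in the same direction merge, so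
    only alternating fences are new. In a fence [id >= g <= h >= Z], any
    subgroup of order [p] is fixed by [g], so it shares the upper bound [h]
    with [Z], which is central once more. In a fence [id <= g >= h <= Z], [g]
    fixes the maximal tori, hence sends an intersection [I] of them into
    itself, and [h I] is a nontrivial subgroup of both [I] and [Z]. Conversely,
    if [E0] meets every nontrivial intersection of maximal tori, let [hull E]
    be the intersection of the maximal tori that contain [E]: the fence
    [E <= hull E >= E0 :&: hull E <= E0] contracts the poset
    ([contractible3_meets]).

    With zero or one step the constant [Z] is the only torus, a maximum or a
    minimum, and a minimum is the only torus because it lies in every subgroup
    of order [p]. *)

(** * Fences of monotone self-maps of a poset *)

Definition comparable_maps (d : Order.disp_t) (X : porderType d)
    (f g : X -> X) : Prop :=
  (forall x, (f x <= g x)%O) \/ (forall x, (g x <= f x)%O).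

Lemma contractible0P (d : Order.disp_t) (X : finPOrderType d) :
  contractible_in_steps X 0 <-> exists x0 : X, forall x, x = x0.
Proof.
split=> [[x0 [f [f0 fn _ _]]] | [x0 eq_x0]].
  by exists x0 => x; rewrite -(f0 x) fn.
by exists x0, (fun=> id); split=> // i _ x y.
Qed.

Lemma contractible1P (d : Order.disp_t) (X : finPOrderType d) :
  contractible_in_steps X 1 <->
  exists x0 : X, comparable_maps id (fun=> x0).
Proof.
split=> [[x0 [f [f0 f1 _ cmpf]]] | [x0 cmp_x0]].
  exists x0; case: (cmpf 0 isT) => le_f; [left | right] => x.
    by have:= le_f x; rewrite f0 f1.
  by have:= le_f x; rewrite f0 f1.
exists x0, (fun i => if i is 0 then id else fun=> x0); split=> //.
  by case=> [|i] _ x y.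
by case.
Qed.

Lemma contractible2P (d : Order.disp_t) (X : finPOrderType d) :
  contractible_in_steps X 2 <->
  exists x0 : X, exists g : X -> X,
    [/\ {homo g : x y / (x <= y)%O}, comparable_maps id g
      & comparable_maps g (fun=> x0)].
Proof.
split=> [[x0 [f [f0 f2 homf cmpf]]] | [x0 [g [homg cmp0 cmp1]]]].
  exists x0, (f 1%N); split; first exact: homf.
    by case: (cmpf 0 isT) => le_f; [left | right] => x; have := le_f x; rewrite f0.
  by case: (cmpf 1%N isT) => le_f; [left | right] => x; have := le_f x; rewrite f2.
exists x0, (nth (fun=> x0) [:: id; g]); split=> //.
  by case=> [|[|[|i]]] //= _ x y; rewrite ?lexx.
by case=> [|[|i]].
Qed.

Lemma contractible3P (d : Order.disp_t) (X : finPOrderType d) :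
  contractible_in_steps X 3 <->
  exists x0 : X, exists g h : X -> X,
    [/\ {homo g : x y / (x <= y)%O}, {homo h : x y / (x <= y)%O},
        comparable_maps id g, comparable_maps g h
      & comparable_maps h (fun=> x0)].
Proof.
split=> [[x0 [f [f0 f3 homf cmpf]]] | [x0 [g [h [homg homh cmp0 cmp1 cmp2]]]]].
  exists x0, (f 1%N), (f 2%N); split; try exact: homf.
  - by case: (cmpf 0 isT) => le_f; [left | right] => x; have := le_f x; rewrite f0.
  - exact: cmpf 1%N isT.
  - by case: (cmpf 2%N isT) => le_f; [left | right] => x; have := le_f x; rewrite f3.
exists x0, (nth (fun=> x0) [:: id; g; h]); split=> //.
  by case=> [|[|[|[|i]]]] //= _ x y; rewrite ?lexx.
by case=> [|[|[|i]]].
Qed.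

(** Two consecutive comparisons in the same direction compose by
    transitivity, so a genuinely three-step contraction alternates. *)
Lemma contractible3_cases (d : Order.disp_t) (X : finPOrderType d) :
  contractible_in_steps X 3 ->
  contractible_in_steps X 2 \/
  exists x0 : X, exists g h : X -> X,
    {homo g : x y / (x <= y)%O} /\
    ([/\ forall x, (x <= g x)%O, forall x, (h x <= g x)%O
       & forall x, (h x <= x0)%O] \/
     [/\ forall x, (g x <= x)%O, forall x, (g x <= h x)%O
       & forall x, (x0 <= h x)%O]).
Proof.
move=> /contractible3P[x0 [g [h [homg homh cmp0 cmp1 cmp2]]]].
case: cmp0 cmp1 => [idg | gid] [gh | hg].
- left; apply/contractible2P; exists x0, h; split=> //.
  by left=> x; apply: le_trans (idg x) (gh x).
- case: cmp2 => [hx0 | x0h].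
    by right; exists x0, g, h; split=> //; left.
  left; apply/contractible2P; exists x0, g; split=> //; first by left.
  by right=> x; apply: le_trans (x0h x) (hg x).
- case: cmp2 => [hx0 | x0h].
    left; apply/contractible2P; exists x0, g; split=> //; first by right.
    by left=> x; apply: le_trans (gh x) (hx0 x).
  by right; exists x0, g, h; split=> //; right.
- left; apply/contractible2P; exists x0, h; split=> //.
  by right=> x; apply: le_trans (hg x) (gid x).
Qed.

(** * Tori and maximal tori *)

Section Tori.

Variables (gT : finGroupType) (p : nat) (G : {group gT}).
Hypothesis p_pr : prime p.
Implicit Types (E F H M Z : {group gT}) (x y : gT).

Lemma ptoriP E :
  reflect [/\ E \subset G, p.-abelem E & E :!=: 1] (E \in ptori p G).
Proof. by rewrite inE; apply: and3P. Qed.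

Lemma ptoriS E F :
  E \in ptori p G -> F \subset E -> F :!=: 1 -> F \in ptori p G.
Proof.
move=> /ptoriP[sEG abE _] sFE ntF; apply/ptoriP.
by split=> //; [apply: subset_trans sEG | apply: abelemS abE].
Qed.

Lemma prime_ptori H : H \subset G -> #|H| = p -> H \in ptori p G.
Proof.
move=> sHG oH; apply/ptoriP; split=> //; last first.
  by rewrite -cardG_gt1 oH prime_gt1.
by rewrite prime_abelem.
Qed.

Lemma cycle_ptori x : x \in G -> #[x] = p -> <[x]>%G \in ptori p G.
Proof. by move=> Gx ox; apply: prime_ptori; rewrite ?cycle_subG. Qed.

Lemma ptori_order E x : E \in ptori p G -> x \in E -> x != 1 -> #[x] = p.
Proof. by move=> /ptoriP[_ abE _]; apply: abelem_order_p. Qed.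

Lemma ptori_dvd E : E \in ptori p G -> p %| #|E|.
Proof.
move=> Et; have [_ _ /trivgPn[x Ex ntx]] := ptoriP _ Et.
by rewrite -(ptori_order Et Ex ntx) order_dvdG.
Qed.

Lemma ptori_sub_of_order_p E (A : {set gT}) :
  E \in ptori p G -> 1 \in A ->
  (forall x, x \in E -> #[x] = p -> x \in A) -> E \subset A.
Proof.
move=> Et A1 sA; apply/subsetP=> x Ex.
by have [-> // | ntx] := eqVneq x 1; apply: sA (ptori_order Et Ex ntx).
Qed.

Lemma ptori_joing E F :
  E \in ptori p G -> F \in ptori p G -> F \subset 'C(E) ->
  (E <*> F)%G \in ptori p G.
Proof.
move=> /ptoriP[sEG abE ntE] /ptoriP[sFG abF _] cEF; apply/ptoriP; split.
- by rewrite join_subG sEG.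
- by rewrite (cprod_abelem p (cprodEY cEF)) abE.
- by apply: subG1_contra ntE; apply: joing_subl.
Qed.

Lemma max_ptori_ptori M : M \in max_ptori p G -> M \in ptori p G.
Proof. by rewrite inE => /maxgroupp. Qed.

Lemma max_ptori_max M E :
  M \in max_ptori p G -> E \in ptori p G -> M \subset E -> E = M.
Proof.
by rewrite inE => /maxgroupP[_ maxM] Et sME; apply/val_inj/maxM.
Qed.

Lemma ptori_sub_max E :
  E \in ptori p G -> exists2 M, M \in max_ptori p G & E \subset M.
Proof.
move=> Et.
have [M maxM sEM] := @maxgroup_exists gT (fun E => E \in ptori p G) E Et.
by exists M; rewrite ?inE.
Qed.

Lemma mem_Omega1 x : x \in G -> #[x] = p -> x \in Omega1 p G.
Proof. by move=> Gx ox; rewrite mem_gen // inE Gx ox eqxx. Qed.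

Lemma Omega1_sub : Omega1 p G \subset G.
Proof. by rewrite gen_subG; apply/subsetP=> x /setIdP[]. Qed.

Lemma ptori_sub_Omega1 E : E \in ptori p G -> E \subset Omega1 p G.
Proof.
move=> Et; apply: (ptori_sub_of_order_p Et (group1 _)) => x Ex ox.
by apply: mem_Omega1 => //; case/ptoriP: Et => /subsetP/(_ x Ex).
Qed.

(** * Tori that centralize every element of order p *)

(** A torus that centralizes a maximal torus generates with it a torus, so it
    already lies inside; conversely every element of order [p] belongs to some
    maximal torus, which is abelian. *)
Lemma ptori_cent_Omega1P Z :
  Z \in ptori p G ->
  reflect (forall M, M \in max_ptori p G -> Z \subset M)
          (Z \subset 'C(Omega1 p G)).
Proof.
move=> Zt; apply: (iffP idP) => [cZ M maxM | sZ].
  have Mt := max_ptori_ptori maxM.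
  have cMZ : Z \subset 'C(M).
    by apply: subset_trans cZ (centS (ptori_sub_Omega1 Mt)).
  rewrite -(max_ptori_max maxM (ptori_joing Mt Zt cMZ)) ?joing_subl //.
  exact: joing_subr.
rewrite centsC gen_subG; apply/subsetP=> x /setIdP[Gx /eqP ox].
have [M maxM sxM] := ptori_sub_max (cycle_ptori Gx ox).
have /ptoriP[_ /abelem_abelian cMM _] := max_ptori_ptori maxM.
have cMZ : M \subset 'C(Z) by apply: sub_abelian_cent2 cMM _ (sZ M maxM).
by apply: (subsetP cMZ); rewrite -cycle_subG.
Qed.

Definition has_central_torus :=
  exists2 Z, Z \in ptori p G & Z \subset 'C(Omega1 p G).

Lemma has_central_torus_dvd : has_central_torus <-> p %| #|'C_G(Omega1 p G)|.
Proof.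
split=> [[Z Zt cZ] | /(Cauchy p_pr)[x /setIP[Gx cx] ox]].
  apply: dvdn_trans (ptori_dvd Zt) (cardSg _).
  by rewrite subsetI cZ andbT; case/ptoriP: Zt.
by exists <[x]>%G; [apply: cycle_ptori | rewrite cycle_subG].
Qed.

Definition bigcapG (S : {set {group gT}}) : {group gT} :=
  bigcap_group (fun M => M \in S) (fun M => M).

Lemma bigcap_ptori (S : {set {group gT}}) :
  S != set0 -> S \subset max_ptori p G ->
  \bigcap_(M in S) M != 1 :> {set gT} -> bigcapG S \in ptori p G.
Proof.
move=> /set0Pn[M SM] /subsetP sS ntS.
by apply: ptoriS (max_ptori_ptori (sS M SM)) _ ntS; apply: (bigcap_inf M).
Qed.

Lemma max_ptori_neq0 : p %| #|G| -> max_ptori p G != set0.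
Proof.
move=> /(Cauchy p_pr)[x Gx ox].
by have [M maxM _] := ptori_sub_max (cycle_ptori Gx ox); apply/set0Pn; exists M.
Qed.

Lemma has_central_torus_bigcap :
  p %| #|G| ->
  has_central_torus <-> \bigcap_(E in max_ptori p G) E != 1 :> {set gT}.
Proof.
move=> pG; split=> [[Z Zt cZ] | ntI].
  have sZ : Z \subset \bigcap_(E in max_ptori p G) E.
    by apply/bigcapsP=> M; apply/(ptori_cent_Omega1P Zt).
  have /ptoriP[_ _ ntZ] := Zt.
  by apply: contraNneq ntZ => I1; rewrite -subG1 -I1.
have It := bigcap_ptori (max_ptori_neq0 pG) (subxx _) ntI.
exists (bigcapG (max_ptori p G)) => //.
by apply/(ptori_cent_Omega1P It) => M maxM; apply: (bigcap_inf M).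
Qed.

Lemma Ap_leE (E F : Ap p G) : (E <= F)%O = (val E \subset val F).
Proof. by []. Qed.

Definition Ap_of E (Et : E \in ptori p G) : Ap p G := exist _ E Et.

Lemma Ap_ptori (E : Ap p G) : val E \in ptori p G.
Proof. exact: valP E. Qed.

(** Two tori with a common upper bound commute, as that bound is abelian. *)
Lemma central_torus_of_bounds (Z : Ap p G) :
  (forall x (Gx : x \in G) (ox : #[x] = p),
     exists2 F : Ap p G, (Ap_of (cycle_ptori Gx ox) <= F)%O & (Z <= F)%O) ->
  has_central_torus.
Proof.
move=> bndZ; exists (val Z); first exact: Ap_ptori.
rewrite centsC gen_subG; apply/subsetP=> x /setIdP[Gx /eqP ox].
have [F sxF sZF] := bndZ x Gx ox.
have /ptoriP[_ /abelem_abelian cFF _] := Ap_ptori F.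
by rewrite -cycle_subG (sub_abelian_cent2 cFF).
Qed.

(** Subgroups of order [p] are minimal tori, as the order of a torus is a
    positive multiple of [p]. *)
Lemma decreasing_fix_prime (g : Ap p G -> Ap p G) x
    (Gx : x \in G) (ox : #[x] = p) :
  (forall E : Ap p G, (g E <= E)%O) ->
  g (Ap_of (cycle_ptori Gx ox)) = Ap_of (cycle_ptori Gx ox).
Proof.
move=> le_g; set X := Ap_of _; apply/val_inj/val_inj/eqP.
have sgX : val (g X) \subset <[x]> := le_g X.
rewrite eqEcard [_ \subset _]sgX /= -orderE ox.
by rewrite dvdn_leq ?cardG_gt0 // ptori_dvd // Ap_ptori.
Qed.

Lemma increasing_fix_max (g : Ap p G -> Ap p G) (M : Ap p G) :
  val M \in max_ptori p G -> (forall E : Ap p G, (E <= g E)%O) -> g M = M.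
Proof.
move=> maxM le_g; apply: val_inj.
exact: max_ptori_max maxM (Ap_ptori _) (le_g M).
Qed.

(** * Contractions in two and three steps *)

Lemma contractible2_central_torus :
  contractible_in_steps (Ap p G) 2 <-> has_central_torus.
Proof.
split=> [/contractible2P[Z [g [homg cmp0 cmp1]]] | [Z Zt cZ]].
  apply: (central_torus_of_bounds (Z := Z)) => x Gx ox.
  set X := Ap_of _.
  (* The upper bound of X and Z is g X if the fence goes up and down, and
     one of X and Z otherwise. *)
  case: cmp1 => [gZ | Zg]; case: cmp0 => [idg | gid].
  - by exists Z => //; apply: le_trans (idg X) (gZ X).
  - by exists Z => //; have := gZ X; rewrite (decreasing_fix_prime Gx ox gid).
  - by exists (g X); [apply: idg | apply: Zg].
  - by exists X => //; apply: le_trans (Zg X) (gid X).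
have jt (E : Ap p G) : (val E <*> Z)%G \in ptori p G.
  apply: ptori_joing (Ap_ptori E) Zt _.
  exact: subset_trans cZ (centS (ptori_sub_Omega1 (Ap_ptori E))).
apply/contractible2P; exists (Ap_of Zt), (fun E : Ap p G => Ap_of (jt E)); split.
- by move=> E F sEF; rewrite Ap_leE /= genS ?setSU.
- by left=> E; rewrite Ap_leE /= joing_subl.
- by right=> E; rewrite Ap_leE /= joing_subr.
Qed.

Definition meets_max_intersections E :=
  forall S : {set {group gT}},
    S != set0 -> S \subset max_ptori p G ->
    \bigcap_(M in S) M != 1 :> {set gT} ->
    E :&: \bigcap_(M in S) M != 1 :> {set gT}.

Lemma central_torus_meets Z :
  Z \in ptori p G -> Z \subset 'C(Omega1 p G) -> meets_max_intersections Z.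
Proof.
move=> Zt cZ S _ /subsetP sS _.
suff /setIidPl-> : Z \subset \bigcap_(M in S) M by case/ptoriP: Zt.
by apply/bigcapsP=> M /sS; apply/(ptori_cent_Omega1P Zt).
Qed.

(** The least intersection of maximal tori above [E]. It replaces [E] because
    [meets_max_intersections] constrains only such intersections. *)
Definition max_hull E : {group gT} :=
  bigcapG [set M in max_ptori p G | E \subset M].

Lemma sub_max_hull E : E \subset max_hull E.
Proof. by apply/bigcapsP=> M /setIdP[]. Qed.

Lemma max_hullS E F : E \subset F -> max_hull E \subset max_hull F.
Proof.
move=> sEF; apply/bigcapsP=> M /setIdP[maxM sFM].
by apply: bigcap_inf; rewrite inE maxM (subset_trans sEF).
Qed.

Lemma max_hull_index E :
  E \in ptori p G ->
  [/\ [set M in max_ptori p G | E \subset M] != set0,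
      [set M in max_ptori p G | E \subset M] \subset max_ptori p G
    & max_hull E :!=: 1].
Proof.
move=> Et; split.
- have [M maxM sEM] := ptori_sub_max Et.
  by apply/set0Pn; exists M; rewrite inE maxM.
- by apply/subsetP=> M /setIdP[].
- by case/ptoriP: Et => _ _; apply: subG1_contra; apply: sub_max_hull.
Qed.

Lemma contractible3_meets :
  contractible_in_steps (Ap p G) 3 <->
  exists2 E, E \in ptori p G & meets_max_intersections E.
Proof.
split=> [|[E0 E0t meetE0]].
  have of_central : has_central_torus ->
      exists2 E, E \in ptori p G & meets_max_intersections E.
    by case=> Z Zt cZ; exists Z => //; apply: central_torus_meets.
  case/contractible3_cases=> [/contractible2_central_torus //|].
  case=> Z [g [h [homg [[idg hg hZ] | [gid gh Zh]]]]]; last first.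
    (* A fence id >= g <= h >= Z: the bound of X = g X and Z is h X. *)
    apply: of_central; apply: (central_torus_of_bounds (Z := Z)) => x Gx ox.
    set X := Ap_of _; exists (h X); last exact: Zh.
    by rewrite -{1}[X](decreasing_fix_prime Gx ox gid).
  (* A fence id <= g >= h <= Z: h I is a nontrivial part of both I and Z. *)
  exists (val Z); first exact: Ap_ptori.
  move=> S S0 sS ntS; pose I := Ap_of (bigcap_ptori S0 sS ntS).
  have sgI : val (g I) \subset \bigcap_(M in S) M.
    apply/bigcapsP=> M SM; have maxM := subsetP sS M SM.
    pose MA := Ap_of (max_ptori_ptori maxM).
    have sIM : (I <= MA)%O by rewrite Ap_leE; apply: (bigcap_inf M).
    by have := homg _ _ sIM; rewrite (@increasing_fix_max g MA).
  have shI : val (h I) \subset val Z :&: \bigcap_(M in S) M.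
    by rewrite subsetI [_ \subset val Z]hZ (subset_trans _ sgI) ?[_ \subset _]hg.
  have /ptoriP[_ _ nth] := Ap_ptori (h I).
  by apply: contraNneq nth => I1; rewrite -subG1 -I1.
have hull_t (E : Ap p G) : max_hull (val E) \in ptori p G.
  by have [S0 sS ntS] := max_hull_index (Ap_ptori E); apply: bigcap_ptori.
have meet_t (E : Ap p G) : (E0 :&: max_hull (val E))%G \in ptori p G.
  have [S0 sS ntS] := max_hull_index (Ap_ptori E).
  by apply: ptoriS E0t (subsetIl _ _) _; apply: meetE0.
apply/contractible3P; exists (Ap_of E0t).
exists (fun E : Ap p G => Ap_of (hull_t E)), (fun E : Ap p G => Ap_of (meet_t E)); split.
- by move=> E F sEF; apply: max_hullS.
- by move=> E F sEF; apply: setIS; apply: max_hullS.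
- by left=> E; apply: sub_max_hull.
- by right=> E; apply: subsetIr.
- by left=> E; apply: subsetIl.
Qed.

(** * Contractions in zero and one step *)

(** A single torus can only be a subgroup of order [p]; conversely a torus is
    the union of its subgroups of order [p] and hence equal to the only one. *)
Lemma contractible0_unique :
  contractible_in_steps (Ap p G) 0 <->
  exists! H : {group gT}, H \subset G /\ #|H| = p.
Proof.
split=> [/contractible0P[Z eqZ] | [H [[sHG oH] uniqH]]].
  have /ptoriP[sZG _ /trivgPn[x Zx ntx]] := Ap_ptori Z.
  have ox := ptori_order (Ap_ptori Z) Zx ntx.
  exists <[x]>%G; split=> [|H [sHG oH]].
    by rewrite cycle_subG (subsetP sZG).
  have := eqZ (Ap_of (prime_ptori sHG oH)).
  rewrite -(eqZ (Ap_of (cycle_ptori (subsetP sZG x Zx) ox))).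
  by case.
apply/contractible0P; exists (Ap_of (prime_ptori sHG oH)) => E.
have /ptoriP[sEG _ _] := Ap_ptori E.
have sEH : val E \subset H.
  apply: ptori_sub_of_order_p (Ap_ptori E) (group1 H) _ => x Ex ox.
  rewrite (uniqH <[x]>%G) ?cycle_id // cycle_subG.
  by rewrite (subsetP sEG).
apply/val_inj/val_inj/eqP; rewrite eqEcard sEH /= oH.
by rewrite dvdn_leq ?cardG_gt0 // ptori_dvd // Ap_ptori.
Qed.

(** A unique subgroup of order [p] contains every element of order [p], so it
    is [Omega1 p G]; a subgroup of order [p] always lies in [Omega1 p G]. *)
Lemma unique_Omega1_isog :
  (exists! H : {group gT}, H \subset G /\ #|H| = p) <->
  Omega1 p G \isog [set: 'Z_p].
Proof.
have oZp : #|[set: 'Z_p]| = p by rewrite cardsT card_ord Zp_cast ?prime_gt1.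
split=> [[H [[sHG oH] uniqH]] | isoO].
  have eqO : Omega1 p G :=: H.
    apply/eqP; rewrite eqEsubset ptori_sub_Omega1 ?prime_ptori // andbT.
    rewrite gen_subG; apply/subsetP=> x /setIdP[Gx /eqP ox].
    by rewrite (uniqH <[x]>%G) ?cycle_id // cycle_subG.
  rewrite eqO isog_cyclic_card ?oZp ?oH ?eqxx ?prime_cyclic ?oH ?oZp //.
have oO : #|Omega1 p G| = p by rewrite (card_isog isoO).
exists (Omega1 p G); split=> [|H [sHG oH]]; first by rewrite Omega1_sub.
apply/val_inj/eqP; rewrite eq_sym eqEcard oO oH leqnn andbT.
exact/ptori_sub_Omega1/prime_ptori.
Qed.

(** A minimum [Z] of the poset lies in every subgroup of order [p], hence is
    the only one; every torus is then [Z] itself. *)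
Lemma contractible1_maximum :
  contractible_in_steps (Ap p G) 1 <-> has_maximum (Ap p G).
Proof.
split=> [/contractible1P[Z [maxZ | minZ]] | [Z maxZ]].
- by exists Z.
- exists Z => E; have /ptoriP[sEG _ _] := Ap_ptori E.
  apply: ptori_sub_of_order_p (Ap_ptori E) (group1 _) _ => x Ex ox.
  have Gx := subsetP sEG x Ex.
  have /= := congr1 val (@decreasing_fix_prime (fun=> Z) x Gx ox minZ).
  by move->; apply: cycle_id.
- by apply/contractible1P; exists Z; left.
Qed.

(** An abelian group generated by elements of order [p] is elementary abelian,
    so [Omega1 p G], which contains all tori, is itself the largest. *)
Lemma maximum_Omega1_abelian :
  p %| #|G| -> has_maximum (Ap p G) <-> abelian (Omega1 p G).
Proof.
move=> pG; split=> [[Z maxZ] | cOO].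
  have /ptoriP[_ /abelem_abelian cZZ _] := Ap_ptori Z.
  apply: abelianS cZZ; rewrite gen_subG.
  apply/subsetP=> x /setIdP[Gx /eqP ox]; rewrite -cycle_subG.
  exact: maxZ (Ap_of (cycle_ptori Gx ox)).
have Ot : Omega1 p G \in ptori p G.
  apply/ptoriP; split; first exact: Omega1_sub.
    rewrite abelemE // cOO /= abelian_exponent_gen; last first.
      by apply: abelianS cOO; apply: subset_gen.
    by apply/exponentP=> x /setIdP[_ /eqP <-]; apply: expg_order.
  have [x Gx ox] := Cauchy p_pr pG.
  apply/trivgPn; exists x; first exact: mem_Omega1.
  by rewrite -order_gt1 ox prime_gt1.
by exists (Ap_of Ot) => E; apply: ptori_sub_Omega1 (Ap_ptori E).
Qed.

End Tori.

Theorem proposition4p5 (gT : finGroupType) (G : {group gT}) (p : nat)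
    (p_pr : prime p) :
  [/\ (* (1) *)
      (contractible_in_steps (Ap p G) 0 <->
         exists! H : {group gT}, H \subset G /\ #|H| = p)
      /\ ((exists! H : {group gT}, H \subset G /\ #|H| = p) <->
         Omega1 p G \isog [set: 'Z_p]),
      (* (2) *)
      (contractible_in_steps (Ap p G) 1 <-> has_maximum (Ap p G))
      /\ (p %| #|G| -> (has_maximum (Ap p G) <-> abelian (Omega1 p G))),
      (* (3) *)
      (p %| #|G| ->
         (contractible_in_steps (Ap p G) 2 <->
            \bigcap_(E in max_ptori p G) E != 1 :> {set gT}))
      /\ (contractible_in_steps (Ap p G) 2 <-> p %| #|'C_G(Omega1 p G)|)
    & (* (4) *)
      contractible_in_steps (Ap p G) 3 <->
        exists2 E : {group gT}, E \in ptori p G &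
          forall S : {set {group gT}},
            S != set0 -> S \subset max_ptori p G ->
            \bigcap_(M in S) M != 1 :> {set gT} ->
            E :&: \bigcap_(M in S) M != 1 :> {set gT}].
Proof.
split.
- by split; [apply: contractible0_unique | apply: unique_Omega1_isog].
- by split; [apply: contractible1_maximum | apply: maximum_Omega1_abelian].
- have central2 := contractible2_central_torus G p_pr.
  split=> [pG|].
    exact: iff_trans central2 (has_central_torus_bigcap p_pr pG).
  exact: iff_trans central2 (has_central_torus_dvd G p_pr).
- exact: contractible3_meets.
Qed.
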